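(* Let $G$ be a finitely generated group and $H$ be a finite group. Suppose that $G$ and $H$ act on each other compatibly and that $H$ acts on $G$ trivially. Then the non-abelian tensor product $G\otimes H$ is finite.
   Context: Groups act on themselves by conjugation on the left: ${}^{g}g'=gg'g^{-1}$. Let $G$ act on $H$ and $H$ act on $G$ by automorphisms (left actions, written ${}^{g}h$ and ${}^{h}g$). The mutual actions are compatible if ${}^{({}^{h}g)}h'={}^{hgh^{-1}}h'$ and ${}^{({}^{g}h)}g'={}^{ghg^{-1}}g'$ for all $g,g'\in G$, $h,h'\in H$, where ${}^{hgh^{-1}}h'$ means $h\cdot {}^{g}(h^{-1}h'h)\cdot h^{-1}$ and ${}^{ghg^{-1}}g'$ means $g\cdot {}^{h}(g^{-1}g'g)\cdot g^{-1}$. For compatible actions, the non-abelian tensor product $G\otimes H$ is the group generated by symbols $g\otimes h$ ($g\in G$, $h\in H$) with relations $gg'\otimes h=({}^{g}g'\otimes {}^{g}h)(g\otimes h)$ and $g\otimes hh'=(g\otimes h)({}^{h}g\otimes {}^{h}h')$ for all $g,g'\in G$, $h,h'\in H$. *)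

(* Defs.v *)
From HB Require Import structures.
From mathcomp Require Import all_boot.
From mathcomp Require Import boolp classical_sets functions cardinality.

Set Implicit Arguments.
Unset Strict Implicit.
Unset Printing Implicit Defensive.

Local Open Scope quotient_scope.
Local Open Scope group_scope.

(* Left conjugation; beware that MathComp's [y ^ x] is x^-1 * y * x. *)
Definition lconj (G : groupType) (x y : G) : G := x * y * x^-1.

(* Subgroups are boolean predicates, which by excluded middle are all subsets. *)
Definition finitely_generated (G : groupType) : Prop :=
  exists s : seq G, forall S : {pred G},
    group_closed S -> {subset s <= S} -> forall x : G, x \in S.

Section Actions.
Variables G H : groupType.

(* The last clause makes each [to x] an endomorphism; it is bijective, hence *)
(* an automorphism, by the first two.                                        *)
Definition acts_by_automorphisms (to : G -> H -> H) : Prop :=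
  [/\ forall y, to 1 y = y,
      forall x x' y, to (x * x') y = to x (to x' y)
    & forall x, {morph to x : y y' / y * y'}].

Definition acts_trivially (to : G -> H -> H) : Prop := forall x y, to x y = y.

End Actions.

Definition compatible_actions (G H : groupType)
    (aGH : G -> H -> H) (aHG : H -> G -> G) : Prop :=
  (forall g h h', aGH (aHG h g) h' = lconj h (aGH g (lconj h^-1 h'))) /\
  (forall g g' h, aHG (aGH g h) g' = lconj g (aHG h (lconj g^-1 g'))).

(* A word is a sequence of letters x^e, where (x, false) is the generator x  *)
(* and (x, true) its formal inverse; [R u v] imposes the relation u = v.     *)
Section Presentation.
Variables (X : choiceType) (R : seq (X * bool) -> seq (X * bool) -> Prop).

Definition word_inv (u : seq (X * bool)) : seq (X * bool) :=
  rev [seq (l.1, ~~ l.2) | l <- u].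

Inductive word_eq : seq (X * bool) -> seq (X * bool) -> Prop :=
| word_eq_refl u : word_eq u u
| word_eq_sym u v : word_eq u v -> word_eq v u
| word_eq_trans u v w : word_eq u v -> word_eq v w -> word_eq u w
| word_eq_cat u u' v v' :
    word_eq u u' -> word_eq v v' -> word_eq (u ++ v) (u' ++ v')
| word_eq_cancel x e : word_eq [:: (x, e); (x, ~~ e)] [::]
| word_eq_rel u v : R u v -> word_eq u v.

Let word_eqb u v := `[< word_eq u v >].

Let word_eqb_equiv : equiv_class_of word_eqb.
Proof.
split=> [u | u v | v u w].
- exact/asboolP/word_eq_refl.
- by apply/asboolP/asboolP; exact: word_eq_sym.
- by move=> /asboolP uv /asboolP vw; apply/asboolP; exact: word_eq_trans uv vw.
Qed.

Canonical word_equiv := EquivRelPack word_eqb_equiv.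

Definition presented := {eq_quot word_equiv}.
HB.instance Definition _ := Choice.on presented.

Definition presented_class (u : seq (X * bool)) : presented :=
  \pi_{eq_quot word_equiv} u.

Lemma presented_classP u v :
  presented_class u = presented_class v <-> word_eq u v.
Proof.
split=> [uv | uv]; first by apply/asboolP; have /eqmodP := uv.
by apply/eqmodP/asboolP.
Qed.

Lemma word_eq_repr u : word_eq (repr (presented_class u)) u.
Proof. by apply/presented_classP; rewrite /presented_class reprK. Qed.

Lemma word_eq_invl u : word_eq (word_inv u ++ u) [::].
Proof.
elim: u => [|[x e] u IH]; first exact: word_eq_refl.
rewrite /word_inv /= rev_cons cat_rcons -cat1s (_ : (x, e) :: u = [:: (x, e)] ++ u) //.
apply: word_eq_trans IH; apply: word_eq_cat (word_eq_refl _) _.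
rewrite catA -[in X in word_eq _ X](cat0s u).
apply: word_eq_cat (word_eq_refl _).
by have := word_eq_cancel x (~~ e); rewrite negbK.
Qed.

Lemma word_invK : involutive word_inv.
Proof.
move=> u; rewrite /word_inv map_rev revK -map_comp -[RHS]map_id.
by apply: eq_map => -[x e] /=; rewrite negbK.
Qed.

Lemma word_eq_invr u : word_eq (u ++ word_inv u) [::].
Proof. by have := word_eq_invl (word_inv u); rewrite word_invK. Qed.

Lemma word_eq_inv u v : word_eq u v -> word_eq (word_inv u) (word_inv v).
Proof.
move=> uv; apply: (@word_eq_trans _ (word_inv u ++ (v ++ word_inv v))).
  rewrite -[X in word_eq X _]cats0; apply: word_eq_cat (word_eq_refl _) _.
  exact/word_eq_sym/word_eq_invr.
rewrite catA -[X in word_eq _ X]cat0s; apply: word_eq_cat (word_eq_refl _).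
apply: word_eq_trans (word_eq_invl u).
exact: word_eq_cat (word_eq_refl _) (word_eq_sym uv).
Qed.

Definition presented_mul (a b : presented) : presented :=
  presented_class (repr a ++ repr b).
Definition presented_inv (a : presented) : presented :=
  presented_class (word_inv (repr a)).

Lemma presented_class_repr a : presented_class (repr a) = a.
Proof. exact: reprK. Qed.

Lemma presented_class_cat u v :
  presented_mul (presented_class u) (presented_class v)
  = presented_class (u ++ v).
Proof. by apply/presented_classP/word_eq_cat; exact: word_eq_repr. Qed.

Lemma presented_class_inv u :
  presented_inv (presented_class u) = presented_class (word_inv u).
Proof. by apply/presented_classP/word_eq_inv/word_eq_repr. Qed.

Lemma presented_mulA : associative presented_mul.
Proof.
move=> a b c; rewrite -[a]presented_class_repr -[b]presented_class_repr.
by rewrite -[c]presented_class_repr !presented_class_cat catA.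
Qed.

Lemma presented_mul1 : left_id (presented_class [::]) presented_mul.
Proof. by move=> a; rewrite -[a]presented_class_repr presented_class_cat. Qed.

Lemma presented_mulr1 : right_id (presented_class [::]) presented_mul.
Proof.
by move=> a; rewrite -[a]presented_class_repr presented_class_cat cats0.
Qed.

Lemma presented_mulV :
  left_inverse (presented_class [::]) presented_inv presented_mul.
Proof.
move=> a; rewrite -[a]presented_class_repr presented_class_inv.
by rewrite presented_class_cat; apply/presented_classP/word_eq_invl.
Qed.

Lemma presented_mulrV :
  right_inverse (presented_class [::]) presented_inv presented_mul.
Proof.
move=> a; rewrite -[a]presented_class_repr presented_class_inv.
by rewrite presented_class_cat; apply/presented_classP/word_eq_invr.
Qed.

HB.instance Definition _ := isGroup.Build presented presented_mulA
  presented_mul1 presented_mulr1 presented_mulV presented_mulrV.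

End Presentation.

Section Tensor.
Variables (G H : groupType) (aGH : G -> H -> H) (aHG : H -> G -> G).

Definition symb (g : G) (h : H) : (G * H) * bool := ((g, h), false).

Inductive tensor_rel : seq ((G * H) * bool) -> seq ((G * H) * bool) -> Prop :=
| tensor_relMl g g' h :
    tensor_rel [:: symb (g * g') h] [:: symb (lconj g g') (aGH g h); symb g h]
| tensor_relMr g h h' :
    tensor_rel [:: symb g (h * h')] [:: symb g h; symb (aHG h g) (lconj h h')].

Definition tensor := presented tensor_rel.
HB.instance Definition _ := Group.on tensor.

End Tensor.

(* Main.v *)
Require Import Defs.
From HB Require Import structures.
From mathcomp Require Import all_boot all_fingroup cyclic.
From mathcomp Require Import boolp classical_sets functions cardinality.

(** When [H] acts trivially on [G], a change of variable removes the
    conjugations from the defining relations: with [x = gg'g^-1] in the first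
    and [y = hh'h^-1] in the second, they become
      [xg (x) h = (x (x) ^g h) (g (x) h)]  and
      [g (x) yh = (g (x) h) (g (x) y)].
    Expanding [xg (x) yh] in the two possible orders and cancelling shows that
    any two symbols commute, so the tensor product is abelian
    ([tensor_commute]). The second relation then says that [g (x) -] is a
    homomorphism on [H], hence every symbol is killed by [#|H|]
    ([tens_torsion]). The first implies that the elements [g] all of whose
    symbols [g (x) h] lie in a given subgroup form a subgroup of [G]
    ([tens_group_closed]); so the finitely many symbols [s (x) h], with [s] in a
    finite generating set of [G], generate everything. Finally, in an abelian
    group, finitely many elements of bounded order lie in a finite subgroup
    ([torsion_in_finite_subgroup]). *)

Set Implicit Arguments.
Unset Strict Implicit.
Unset Printing Implicit Defensive.

Local Open Scope group_scope.

(** Adding a generator [x] to a subgroup [E] gives the products [x ^+ i * y]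
    with [i < N] and [y] in [E], again finite in number. *)
Lemma torsion_in_finite_subgroup (T : groupType) (N : nat) (l : seq T) :
    0 < N -> (forall x y : T, commute x y) ->
    {in l, forall x, x ^+ N = 1} ->
  exists E : seq T, group_closed (mem E) /\ {subset l <= E}.
Proof.
move=> N_gt0 cT; elim: l => [_|x l IHl torl].
  exists [:: 1]; split=> //; split=> [|y z]; rewrite !inE // => /eqP-> /eqP->.
  by rewrite divg1.
have [y ly|E [Egrp lE]] := IHl; first by apply: torl; rewrite inE ly orbT.
have xN : x ^+ N = 1 by apply: torl; rewrite mem_head.
have [E1 EB] := Egrp.
pose F := [seq x ^+ i * y | i <- iota 0 N, y <- E].
have memF i y : y \in E -> x ^+ i * y \in F.
  move=> Ey; have -> : x ^+ i = x ^+ (i %% N).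
    by rewrite {1}(divn_eq i N) expgnDr mulnC expgnA xN expg1n mul1g.
  by apply: allpairs_f; rewrite // mem_iota ltn_pmod.
(* Negative powers of [x] are nonnegative ones. *)
have xV : x^-1 = x ^+ N.-1.
  by apply: (mulgI x); rewrite -expgS prednK // xN mulgV.
exists F; split; first split.
- by have := memF 0%N 1 E1; rewrite expg0 mulg1.
- move=> _ _ /allpairsP[[i y] /= [_ Ey ->]] /allpairsP[[j z] /= [_ Ez ->]].
  have -> : x ^+ i * y * (x ^+ j * z)^-1 = x ^+ (i + N.-1 * j) * (y * z^-1).
    rewrite invgM expgnDr expgnA -xV expVgn -!mulgA; congr (_ * _).
    by rewrite mulgA; exact: cT.
  exact/memF/EB.
- move=> y; rewrite inE => /predU1P[->|/lE Ey].
    by have := memF 1%N 1 E1; rewrite expg1 mulg1.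
  by have := memF 0%N y Ey; rewrite expg0 mul1g.
Qed.

Section TrivialAction.
Variables (G H : groupType) (aGH : G -> H -> H) (aHG : H -> G -> G).
Hypotheses (actGH : acts_by_automorphisms aGH) (trivHG : acts_trivially aHG).

Local Notation T := (tensor aGH aHG).

Definition tens (g : G) (h : H) : T := presented_class _ [:: symb g h].

Lemma tensor_ind (S : T -> Prop) :
    S 1 -> (forall t u, S t -> S u -> S (t * u^-1)) -> (forall g h, S (tens g h)) ->
  forall t, S t.
Proof.
move=> S1 SB Ssymb t; rewrite -[t]presented_class_repr.
have SV u : S u -> S u^-1 by move=> Su; rewrite -[u^-1]div1g; exact: SB.
have SM u v : S u -> S v -> S (u * v).
  by move=> Su Sv; rewrite -[v]invgK; exact/SB/SV.
elim: {t}(generic_quotient.repr t) => [|[[g h] e] w Sw]; first exact: S1.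
rewrite -cat1s -presented_class_cat; apply: (SM _ _ _ Sw).
case: e; last exact: Ssymb.
suff -> : presented_class _ [:: ((g, h), true)] = (tens g h)^-1 by exact: SV.
by rewrite /tens [RHS]presented_class_inv.
Qed.

(** The first defining relation for [g' = g^-1 x g]; since [x] and [g] are now
    arbitrary, it describes how the symbols depend on a product in [G]. *)
Lemma tensMl x g h : tens (x * g) h = tens x (aGH g h) * tens g h.
Proof.
have -> : x * g = g * (g^-1 * x * g) by rewrite -!mulgA mulVKg.
have {2}-> : x = lconj g (g^-1 * x * g).
  by rewrite /lconj -!mulgA mulVKg mulgV mulg1.
rewrite [RHS]presented_class_cat.
exact/presented_classP/word_eq_rel/tensor_relMl.
Qed.

(** The second defining relation for [h' = h^-1 y h]; triviality of the action
    of [H] keeps [g] unchanged in the second factor. *)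
Lemma tensMr g y h : tens g (y * h) = tens g h * tens g y.
Proof.
have -> : y * h = h * (h^-1 * y * h) by rewrite -!mulgA mulVKg.
have {2}-> : y = lconj h (h^-1 * y * h).
  by rewrite /lconj -!mulgA mulVKg mulgV mulg1.
rewrite -{3}(trivHG h g) [RHS]presented_class_cat.
exact/presented_classP/word_eq_rel/tensor_relMr.
Qed.

Lemma actKV g h : aGH g (aGH g^-1 h) = h.
Proof. by case: actGH => a1 aM _; rewrite -aM mulgV a1. Qed.

Lemma tens1g h : tens 1 h = 1.
Proof.
case: actGH => a1 _ _; apply: (mulIg (tens 1 h)).
by rewrite mul1g -{1}[h]a1 -tensMl mulg1.
Qed.

Lemma tensg1 g : tens g 1 = 1.
Proof. by apply: (mulgI (tens g 1)); rewrite -tensMr !mulg1. Qed.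

(** Compare the two expansions of [xg (x) yh], where [^g y = k]. *)
Lemma symb_commute g h x k : commute (tens g h) (tens x k).
Proof.
case: actGH => _ _ aM; rewrite -(actKV g k); set y := aGH _ k.
have /esym := tensMl x g (y * h).
rewrite tensMr aM !tensMr !tensMl -!mulgA => /mulgI.
by rewrite !mulgA => /mulIg /esym.
Qed.

Lemma tensor_commute (t u : T) : commute t u.
Proof.
have cB (v : T) t1 t2 : commute v t1 -> commute v t2 -> commute v (t1 * t2^-1).
  by move=> c1 c2; apply: commuteM => //; exact: commuteV.
elim/tensor_ind: u => [|u v|g h]; [exact: commute1 | exact: cB |].
apply: commute_sym; elim/tensor_ind: t => [|t u|x k]; first exact: commute1.
  exact: cB.
exact: symb_commute.
Qed.

Lemma tens_torsion g h n : h ^+ n = 1 -> tens g h ^+ n = 1.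
Proof.
suff <- : tens g (h ^+ n) = tens g h ^+ n by move=> ->; exact: tensg1.
elim: n => [|n IHn]; first exact: tensg1.
by rewrite expgS tensMr IHn -expgSr.
Qed.

(** If [^y k = h], then [tensMl] for the product [x = (x y^-1) y] reads
    [x y^-1 (x) h = (x (x) k) (y (x) k)^-1]. *)
Lemma tens_group_closed (K : {pred T}) :
  group_closed K -> group_closed [pred g | `[< forall h, tens g h \in K >]].
Proof.
move=> [K1 KB]; split=> [|x y /asboolP Kx /asboolP Ky]; apply/asboolP => h.
  by rewrite tens1g.
have -> : tens (x * y^-1) h = tens x (aGH y^-1 h) * (tens y (aGH y^-1 h))^-1.
  by rewrite -{2}[x](divgK y) [in RHS]tensMl actKV mulgK.
exact: KB.
Qed.

End TrivialAction.

Theorem corollary4p8 (G : groupType) (H : finGroupType)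
    (aGH : G -> H -> H) (aHG : H -> G -> G)
    (fgG : finitely_generated G)
    (actGH : acts_by_automorphisms aGH)
    (actHG : acts_by_automorphisms aHG)
    (compat : compatible_actions aGH aHG)
    (trivHG : acts_trivially aHG) :
  finite_set [set: tensor aGH aHG]%classic.
Proof.
have [s genG] := fgG.
pose l := [seq tens aGH aHG g h | g <- s, h <- enum H].
have torl : {in l, forall t, t ^+ #|H| = 1}.
  move=> _ /allpairsP[[g h] /= [_ _ ->]]; apply: tens_torsion => //.
  by rewrite -cardsT; exact: (expg_cardG (finset.in_setT h)).
have H_gt0 : 0 < #|H| by apply/card_gt0P; exists 1.
have [E [Egrp lE]] :=
  torsion_in_finite_subgroup H_gt0 (tensor_commute actGH trivHG) torl.
have symbE g h : tens aGH aHG g h \in E.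
  suff sE : {subset s <= [pred x | `[< forall k, tens aGH aHG x k \in E >]]}.
    by have /asboolP := genG _ (tens_group_closed actGH Egrp) sE g.
  move=> x sx; apply/asboolP => k; apply: lE.
  by apply: allpairs_f; rewrite ?mem_enum.
apply: sub_finite_set (finite_seq E) => t _ /=.
have [E1 EB] := Egrp.
by elim/tensor_ind: t => [|t u|g h]; [exact: E1 | exact: EB | exact: symbE].
Qed.
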